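(* Let $(\Phi,\phi,\widetilde\phi):(\mathcal C,p,pt)\to(\mathcal C',p',pt')$ be a functor of universe categories and let $H=H(\Phi,\phi,\widetilde\phi):CC(\mathcal C,p)\to CC(\mathcal C',p')$ be the homomorphism of C-systems associated with it (see context). Then: 1. If $\Phi$ is a faithful functor and $\phi$ is a monomorphism, then $H$ is an injection of C-systems (i.e. injective on objects and on morphisms). 2. If $\Phi$ is a fully faithful functor and $\phi$ is an isomorphism, then $H$ is an isomorphism of C-systems.
   Context: Composition of morphisms is written in diagrammatic order: $f\circ g$ means first $f$, then $g$. **Universe categories.** A universe structure on a morphism $p:\widetilde U\to U$ of a category $\mathcal C$ assigns to every morphism $F:X\to U$ a pull-back square (the canonical square of $F$) with vertex $(X;F)$ and projections $p_{X,F}:(X;F)\to X$, $Q(F):(X;F)\to\widetilde U$ (so $p_{X,F}\circ F=Q(F)\circ p$). For $f:W\to X$, $g:W\to\widetilde U$ with $f\circ F=g\circ p$, $f*g:W\to (X;F)$ is the unique morphism with $(f*g)\circ p_{X,F}=f$ and $(f*g)\circ Q(F)=g$. For $f:X'\to X$ and $F:X\to U$ put $Q(f,F)=(p_{X',f\circ F}\circ f)*Q(f\circ F):(X';f\circ F)\to(X;F)$. A universe category is a triple $(\mathcal C,p,pt)$ where $p$ is a morphism of $\mathcal C$ equipped with a universe structure and $pt$ is a (chosen) final object of $\mathcal C$. **C-systems.** A C0-system is a (small) category $CC$ with a function $l:Ob(CC)\to\mathbb N$, an object $pt$, a function $ft:Ob(CC)\to Ob(CC)$, for each $X$ a morphism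 $p_X:X\to ft(X)$, and for each $X$ with $l(X)>0$ and each $f:Y\to ft(X)$ an object $f^*(X)$ and a morphism $q(f,X):f^*(X)\to X$, such that: (1) $l^{-1}(0)=\{pt\}$; (2) $l(ft(X))=l(X)-1$ if $l(X)>0$; (3) $ft(pt)=pt$; (4) $pt$ is final; (5) if $l(X)>0$ and $f:Y\to ft(X)$ then $l(f^*(X))>0$, $ft(f^*(X))=Y$ and $p_{f^*(X)}\circ f=q(f,X)\circ p_X$; (6) if $l(X)>0$ then $Id_{ft(X)}^*(X)=X$ and $q(Id_{ft(X)},X)=Id_X$; (7) if $l(X)>0$, $f:Y\to ft(X)$, $g:Z\to Y$, then $(g\circ f)^*(X)=g^*(f^*(X))$ and $q(g\circ f,X)=q(g,f^*(X))\circ q(f,X)$. A C-system is a C0-system with an operation assigning to each $f:Y\to X$ with $l(X)>0$ a morphism $s_f:Y\to (f\circ p_X)^*(X)$ such that $s_f\circ p_{(f\circ p_X)^*(X)}=Id_Y$, $f=s_f\circ q(f\circ p_X,X)$, and, whenever $X=g^*(Z)$ with $l(Z)>0$ and $g:ft(X)\to ft(Z)$, $s_f=s_{f\circ q(g,Z)}$. A homomorphism of C-systems is a functor $F$ between the underlying categories (functions on $Ob$ and $Mor$) commuting with $l$ and $ft$ and such that $F(p_X)=p_{F(X)}$ for all $X$, $F(q(f,Y))=q(F(f),F(Y))$ for $l(Y)>0$, $f:X\to ft(Y)$, and $F(s_f)=s_{F(f)}$ for $f:X\to Y$, $l(Y)>0$. It is an isomorphism if it has an inverse homomorphism. **The C-system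 $CC(\mathcal C,p)$.** Define by induction sets $Ob_n=Ob_n(\mathcal C,p)$ and functions $int:Ob_n\to Ob(\mathcal C)$: $Ob_0=\{tt\}$, $int(tt)=pt$; $Ob_{n+1}=\coprod_{A\in Ob_n}Hom_{\mathcal C}(int(A),U)$, $int(A,F)=(int(A);F)$. Then $CC(\mathcal C,p)$ has objects the pairs $(n,A)$, $A\in Ob_n$, with $int(n,A)=int(A)$; morphisms $\Gamma\to\Gamma'$ are the elements $(\Gamma,(\Gamma',a))$ with $a\in Hom_{\mathcal C}(int(\Gamma),int(\Gamma'))$, and $int$ of such a morphism is $a$; identities and composition are those of $\mathcal C$; $l(n,A)=n$; $pt=(0,tt)$; $ft(n+1,(B,F))=(n,B)$, $ft(0,tt)=(0,tt)$; $int(p_{(n+1,(B,F))})=p_{int(B),F}$, $p_{(0,tt)}=Id$; for $\Delta=(n+1,(B,F))$ and $f:(m,A)\to(n,B)$, $f^*(\Delta)=(m+1,(A,int(f)\circ F))$ and $int(q(f,\Delta))=Q(int(f),F)$; the $s$-operation is the unique one making this a C-system. **Functors of universe categories.** A functor of universe categories $(\mathcal C,p,pt)\to(\mathcal C',p',pt')$ is a triple $(\Phi,\phi,\widetilde\phi)$ of a functor $\Phi:\mathcal C\to\mathcal C'$ and morphisms $\phi:\Phi(U)\to U'$, $\widetilde\phi:\Phi(\widetilde U)\to\widetilde U'$ such that $\Phi$ takes the canonical pull-back squares based on $p$ to pull-back squares, $\Phi(pt)$ is final in $\mathcal C'$, and the square with sides $\widetilde\phi$, $\Phi(p)$, $p'$,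 $\phi$ (i.e. $\widetilde\phi\circ p'=\Phi(p)\circ\phi$) is a pull-back square. **The homomorphism $H(\Phi,\phi,\widetilde\phi)$.** Let $Ob_n=Ob_n(\mathcal C,p)$, $Ob'_n=Ob_n(\mathcal C',p')$, with functions $int$, $int'$. Define recursively functions $H_n:Ob_n\to Ob'_n$ and families of isomorphisms $\psi_n(A):int'(H_n(A))\to\Phi(int(A))$, $A\in Ob_n$: $H_0$ is the unique map and $\psi_0(tt):pt'\to\Phi(pt)$ the unique isomorphism; $H_{n+1}(A,F)=(H_n(A),\psi_n(A)\circ\Phi(F)\circ\phi)$ and $\psi_{n+1}(A,F):int'(H_{n+1}(A,F))\to\Phi(int(A,F))$ is the unique morphism such that $\psi_{n+1}(A,F)\circ\Phi(p_{int(A),F})=p_{int'(H_n(A)),\psi_n(A)\circ\Phi(F)\circ\phi}\circ\psi_n(A)$ and $\psi_{n+1}(A,F)\circ\Phi(Q(F))\circ\widetilde\phi=Q(\psi_n(A)\circ\Phi(F)\circ\phi)$. For $A\in Ob_m$, $A'\in Ob_{m'}$ and $a:int(A)\to int(A')$ put $H(a)=\psi_m(A)\circ\Phi(a)\circ\psi_{m'}(A')^{-1}$. Then $H(n,A)=(n,H_n(A))$ on objects and $H(\Gamma,(\Gamma',a))=(H(\Gamma),(H(\Gamma'),H(a)))$ on morphisms; this is a homomorphism of C-systems. *)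

(* Defs.v *)
From mathcomp Require Import ssreflect ssrfun ssrbool eqtype ssrnat.
From Stdlib Require Import Description ProofIrrelevance.

Set Implicit Arguments.
Unset Strict Implicit.
Unset Printing Implicit Defensive.

Declare Scope cat_scope.
Delimit Scope cat_scope with cat.
Local Open Scope cat_scope.

Reserved Notation "f ;; g" (at level 45, left associativity).

Record Category := {
  Ob :> Type;
  Hom : Ob -> Ob -> Type;
  idm : forall X, Hom X X;
  compm : forall X Y Z, Hom X Y -> Hom Y Z -> Hom X Z;
  comp1f : forall X Y (f : Hom X Y), compm (idm X) f = f;
  compf1 : forall X Y (f : Hom X Y), compm f (idm Y) = f;
  compA : forall X Y Z W (f : Hom X Y) (g : Hom Y Z) (h : Hom Z W),
    compm f (compm g h) = compm (compm f g) h
}.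

Arguments Hom {c} X Y.
Arguments idm {c} X.
Arguments compm {c X Y Z} f g.

(* Diagrammatic order: first [f], then [g]. *)
Notation "f ;; g" := (compm f g) : cat_scope.

(* The set of all morphisms.  Equations between morphisms whose (co)domains
   are only provably equal are stated as equations in [Mor C]. *)
Definition Mor (C : Category) : Type := {X : C & {Y : C & Hom X Y}}.

Definition arr (C : Category) (X Y : C) (f : Hom X Y) : Mor C :=
  existT _ X (existT _ Y f).

(* The identity morphism along an equality of objects: used only to make
   composites such as [p (f^* X) ;; f] typecheck. *)
Definition eqmor (C : Category) (X Y : C) (e : X = Y) : Hom X Y :=
  match e in _ = Z return Hom X Z with erefl => idm X end.

Definition mono (C : Category) (X Y : C) (f : Hom X Y) : Prop :=
  forall (W : C) (g h : Hom W X), g ;; f = h ;; f -> g = h.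

Definition inverses (C : Category) (X Y : C) (f : Hom X Y) (g : Hom Y X) :
  Prop := f ;; g = idm X /\ g ;; f = idm Y.

Definition is_iso (C : Category) (X Y : C) (f : Hom X Y) : Prop :=
  exists g : Hom Y X, inverses f g.

Record Iso (C : Category) (X Y : C) := {
  iso_hom :> Hom X Y;
  iso_inv : Hom Y X;
  iso_inverses : inverses iso_hom iso_inv
}.

Definition is_final (C : Category) (T : C) : Prop :=
  forall X : C, exists! f : Hom X T, True.

(*   P --b--> Y
     |a       |g
     X --f--> Z   *)
Definition is_pullback (C : Category) (P X Y Z : C)
    (a : Hom P X) (b : Hom P Y) (f : Hom X Z) (g : Hom Y Z) : Prop :=
  a ;; f = b ;; g /\
  forall (W : C) (u : Hom W X) (v : Hom W Y), u ;; f = v ;; g ->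
    exists! w : Hom W P, w ;; a = u /\ w ;; b = v.

Record Functor (C D : Category) := {
  fob :> C -> D;
  fmor : forall X Y : C, Hom X Y -> Hom (fob X) (fob Y);
  fmor_id : forall X : C, fmor (idm X) = idm (fob X);
  fmor_comp : forall (X Y Z : C) (f : Hom X Y) (g : Hom Y Z),
    fmor (f ;; g) = fmor f ;; fmor g
}.

Arguments fmor {C D} F {X Y} f : rename.

Definition fMor (C D : Category) (F : Functor C D) (m : Mor C) : Mor D :=
  arr (fmor F (projT2 (projT2 m))).

Definition faithful (C D : Category) (F : Functor C D) : Prop :=
  forall X Y : C, injective (@fmor C D F X Y).

Definition fully_faithful (C D : Category) (F : Functor C D) : Prop :=
  forall X Y : C, bijective (@fmor C D F X Y).

Lemma eqmor_id (C : Category) (X : C) (e : X = X) : eqmor e = idm X.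
Proof. by rewrite (proof_irrelevance _ e erefl). Qed.

Lemma iso_homK (C : Category) (X Y : C) (i : Iso X Y) :
  iso_hom i ;; iso_inv i = idm X.
Proof. by case: (iso_inverses i). Qed.

Lemma iso_invK (C : Category) (X Y : C) (i : Iso X Y) :
  iso_inv i ;; iso_hom i = idm Y.
Proof. by case: (iso_inverses i). Qed.

Definition final_map (C : Category) (T : C) (fT : is_final T) (X : C) :
  Hom X T := proj1_sig (constructive_definite_description _ (fT X)).

Lemma final_uniq (C : Category) (T : C) (fT : is_final T) (X : C)
  (f g : Hom X T) : f = g.
Proof. by case: (fT X) => h [_ u]; rewrite -(u f) // -(u g). Qed.

Definition pb_lift (C : Category) (P X Y Z : C) (a : Hom P X) (b : Hom P Y)
    (f : Hom X Z) (g : Hom Y Z) (pb : is_pullback a b f g)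
    (W : C) (u : Hom W X) (v : Hom W Y) (e : u ;; f = v ;; g) : Hom W P :=
  proj1_sig (constructive_definite_description _ (proj2 pb W u v e)).

Section PullbackTheory.
Context {C : Category} {P X Y Z : C} {a : Hom P X} {b : Hom P Y}
  {f : Hom X Z} {g : Hom Y Z} (pb : is_pullback a b f g).

Lemma pb_lift_fst (W : C) (u : Hom W X) (v : Hom W Y) (e : u ;; f = v ;; g) :
  pb_lift pb e ;; a = u.
Proof.
by rewrite /pb_lift; case: constructive_definite_description => w [].
Qed.

Lemma pb_lift_snd (W : C) (u : Hom W X) (v : Hom W Y) (e : u ;; f = v ;; g) :
  pb_lift pb e ;; b = v.
Proof.
by rewrite /pb_lift; case: constructive_definite_description => w [].
Qed.

Lemma pullback_uniq (W : C) (w w' : Hom W P) :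
  w ;; a = w' ;; a -> w ;; b = w' ;; b -> w = w'.
Proof.
move=> ea eb; case: pb => comm univ.
have e : (w ;; a) ;; f = (w ;; b) ;; g by rewrite -!compA comm.
case: (univ W _ _ e) => h [_ u].
by rewrite -(u w) // -(u w').
Qed.

End PullbackTheory.

Record UniverseStructure (C : Category) (Ut U : C) (p : Hom Ut U) := {
  us_ext : forall X : C, Hom X U -> C;
  us_p : forall (X : C) (F : Hom X U), Hom (us_ext F) X;
  us_Q : forall (X : C) (F : Hom X U), Hom (us_ext F) Ut;
  us_pullback : forall (X : C) (F : Hom X U),
    is_pullback (us_p F) (us_Q F) F p
}.

Record UniverseCategory := {
  uc_cat :> Category;
  uc_U : uc_cat;
  uc_Ut : uc_cat;
  uc_mor : Hom uc_Ut uc_U;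
  uc_struct : UniverseStructure uc_mor;
  uc_pt : uc_cat;
  uc_final : is_final uc_pt
}.

Definition ext (C : UniverseCategory) (X : C) (F : Hom X (uc_U C)) : C :=
  us_ext (uc_struct C) F.

Definition pr (C : UniverseCategory) (X : C) (F : Hom X (uc_U C)) :
  Hom (ext F) X := us_p (uc_struct C) F.

Definition Qm (C : UniverseCategory) (X : C) (F : Hom X (uc_U C)) :
  Hom (ext F) (uc_Ut C) := us_Q (uc_struct C) F.

Definition canonical_square (C : UniverseCategory) (X : C)
    (F : Hom X (uc_U C)) : is_pullback (pr F) (Qm F) F (uc_mor C) :=
  us_pullback (uc_struct C) F.

(* The morphism [f * g]. *)
Definition star (C : UniverseCategory) (X W : C) (F : Hom X (uc_U C))
    (f : Hom W X) (g : Hom W (uc_Ut C)) (e : f ;; F = g ;; uc_mor C) :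
  Hom W (ext F) := pb_lift (canonical_square F) e.

Lemma star_pr (C : UniverseCategory) (X W : C) (F : Hom X (uc_U C))
    (f : Hom W X) (g : Hom W (uc_Ut C)) (e : f ;; F = g ;; uc_mor C) :
  star e ;; pr F = f.
Proof. exact: pb_lift_fst. Qed.

Lemma star_Q (C : UniverseCategory) (X W : C) (F : Hom X (uc_U C))
    (f : Hom W X) (g : Hom W (uc_Ut C)) (e : f ;; F = g ;; uc_mor C) :
  star e ;; Qm F = g.
Proof. exact: pb_lift_snd. Qed.

Lemma ext_uniq (C : UniverseCategory) (X W : C) (F : Hom X (uc_U C))
    (w w' : Hom W (ext F)) :
  w ;; pr F = w' ;; pr F -> w ;; Qm F = w' ;; Qm F -> w = w'.
Proof. exact: (pullback_uniq (canonical_square F)). Qed.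

Lemma Q2_comm (C : UniverseCategory) (X' X : C) (f : Hom X' X)
    (F : Hom X (uc_U C)) :
  (pr (f ;; F) ;; f) ;; F = Qm (f ;; F) ;; uc_mor C.
Proof. by rewrite -compA; exact: (proj1 (canonical_square (f ;; F))). Qed.

(* The morphism [Q(f, F)]. *)
Definition Q2 (C : UniverseCategory) (X' X : C) (f : Hom X' X)
    (F : Hom X (uc_U C)) : Hom (ext (f ;; F)) (ext F) :=
  star (Q2_comm f F).

Lemma Q2_pr (C : UniverseCategory) (X' X : C) (f : Hom X' X)
    (F : Hom X (uc_U C)) : Q2 f F ;; pr F = pr (f ;; F) ;; f.
Proof. exact: star_pr. Qed.

Lemma Q2_Q (C : UniverseCategory) (X' X : C) (f : Hom X' X)
    (F : Hom X (uc_U C)) : Q2 f F ;; Qm F = Qm (f ;; F).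
Proof. exact: star_Q. Qed.

Lemma Q2_prA (C : UniverseCategory) (W X' X : C) (f : Hom X' X)
    (F : Hom X (uc_U C)) (w : Hom W (ext (f ;; F))) :
  w ;; Q2 f F ;; pr F = w ;; pr (f ;; F) ;; f.
Proof. by rewrite -compA Q2_pr compA. Qed.

Lemma Q2_QA (C : UniverseCategory) (W X' X : C) (f : Hom X' X)
    (F : Hom X (uc_U C)) (w : Hom W (ext (f ;; F))) :
  w ;; Q2 f F ;; Qm F = w ;; Qm (f ;; F).
Proof. by rewrite -compA Q2_Q. Qed.

Lemma Q2_comp (C : UniverseCategory) (X'' X' X : C) (g : Hom X'' X')
    (f : Hom X' X) (F : Hom X (uc_U C))
    (c : Hom (ext (g ;; f ;; F)) (ext (g ;; (f ;; F)))) :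
  c ;; pr _ = pr _ -> c ;; Qm _ = Qm _ ->
  c ;; (Q2 g (f ;; F) ;; Q2 f F) = Q2 (g ;; f) F.
Proof.
move=> cp cQ; apply: ext_uniq.
  by rewrite compA Q2_prA Q2_prA cp Q2_pr (compA (pr _)).
by rewrite compA Q2_QA Q2_QA cQ Q2_Q.
Qed.

Record C0System := {
  c0_cat :> Category;
  c0_l : c0_cat -> nat;
  c0_pt : c0_cat;
  c0_ft : c0_cat -> c0_cat;
  c0_p : forall X : c0_cat, Hom X (c0_ft X);
  c0_pull : forall (X : c0_cat) (hX : 0 < c0_l X)
    (Y : c0_cat) (f : Hom Y (c0_ft X)), c0_cat;
  c0_q : forall (X : c0_cat) (hX : 0 < c0_l X)
    (Y : c0_cat) (f : Hom Y (c0_ft X)), Hom (c0_pull hX f) X;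
  c0_l0 : forall X : c0_cat, c0_l X = 0 <-> X = c0_pt;
  c0_l_ft : forall X : c0_cat, 0 < c0_l X -> c0_l (c0_ft X) = c0_l X - 1;
  c0_ft_pt : c0_ft c0_pt = c0_pt;
  c0_pt_final : is_final c0_pt;
  c0_l_pull : forall (X : c0_cat) (hX : 0 < c0_l X)
    (Y : c0_cat) (f : Hom Y (c0_ft X)), 0 < c0_l (c0_pull hX f);
  c0_ft_pull : forall (X : c0_cat) (hX : 0 < c0_l X)
    (Y : c0_cat) (f : Hom Y (c0_ft X)), c0_ft (c0_pull hX f) = Y;
  c0_p_pull : forall (X : c0_cat) (hX : 0 < c0_l X)
    (Y : c0_cat) (f : Hom Y (c0_ft X)),
    c0_p (c0_pull hX f) ;; eqmor (c0_ft_pull hX f) ;; f = c0_q hX f ;; c0_p X;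
  c0_pull_id : forall (X : c0_cat) (hX : 0 < c0_l X),
    c0_pull hX (idm (c0_ft X)) = X;
  c0_q_id : forall (X : c0_cat) (hX : 0 < c0_l X),
    arr (c0_q hX (idm (c0_ft X))) = arr (idm X);
  c0_pull_comp : forall (X : c0_cat) (hX : 0 < c0_l X)
    (Y : c0_cat) (f : Hom Y (c0_ft X)) (Z : c0_cat) (g : Hom Z Y),
    c0_pull hX (g ;; f) =
    c0_pull (c0_l_pull hX f) (g ;; eqmor (esym (c0_ft_pull hX f)));
  c0_q_comp : forall (X : c0_cat) (hX : 0 < c0_l X)
    (Y : c0_cat) (f : Hom Y (c0_ft X)) (Z : c0_cat) (g : Hom Z Y),
    arr (c0_q hX (g ;; f)) =
    arr (c0_q (c0_l_pull hX f) (g ;; eqmor (esym (c0_ft_pull hX f)))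
         ;; c0_q hX f)
}.

Record CSystem := {
  cs_c0 :> C0System;
  cs_s : forall (X : cs_c0) (hX : 0 < c0_l X) (Y : cs_c0) (f : Hom Y X),
    Hom Y (c0_pull hX (f ;; c0_p X));
  cs_s_p : forall (X : cs_c0) (hX : 0 < c0_l X) (Y : cs_c0) (f : Hom Y X),
    cs_s hX f ;; c0_p (c0_pull hX (f ;; c0_p X))
      ;; eqmor (c0_ft_pull hX (f ;; c0_p X)) = idm Y;
  cs_s_q : forall (X : cs_c0) (hX : 0 < c0_l X) (Y : cs_c0) (f : Hom Y X),
    f = cs_s hX f ;; c0_q hX (f ;; c0_p X);
  cs_s_pull : forall (X : cs_c0) (hX : 0 < c0_l X) (Z : cs_c0)
    (hZ : 0 < c0_l Z) (g : Hom (c0_ft X) (c0_ft Z)) (e : X = c0_pull hZ g)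
    (Y : cs_c0) (f : Hom Y X),
    arr (cs_s hX f) = arr (cs_s hZ (f ;; eqmor e ;; c0_q hZ g))
}.

Record CSystemHom (A B : CSystem) := {
  csh_fun :> Functor A B;
  csh_l : forall X : A, c0_l (csh_fun X) = c0_l X;
  csh_ft : forall X : A, c0_ft (csh_fun X) = csh_fun (c0_ft X);
  csh_p : forall X : A, arr (fmor csh_fun (c0_p X)) = arr (c0_p (csh_fun X));
  csh_q : forall (Y : A) (hY : 0 < c0_l Y) (hY' : 0 < c0_l (csh_fun Y))
    (X : A) (f : Hom X (c0_ft Y)),
    arr (fmor csh_fun (c0_q hY f)) =
    arr (c0_q hY' (fmor csh_fun f ;; eqmor (esym (csh_ft Y))));
  csh_s : forall (Y : A) (hY : 0 < c0_l Y) (hY' : 0 < c0_l (csh_fun Y))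
    (X : A) (f : Hom X Y),
    arr (fmor csh_fun (cs_s hY f)) = arr (cs_s hY' (fmor csh_fun f))
}.

Definition cs_injection (A B : CSystem) (F : CSystemHom A B) : Prop :=
  injective (fob F) /\ injective (fMor F).

Definition cs_isomorphism (A B : CSystem) (F : CSystemHom A B) : Prop :=
  exists G : CSystemHom B A,
    [/\ cancel (fob F) (fob G), cancel (fob G) (fob F),
        cancel (fMor F) (fMor G) & cancel (fMor G) (fMor F)].

(* [Ob_n] and [cc_int : Ob_n -> C] by simultaneous recursion on [n]. *)
Fixpoint obint (C : UniverseCategory) (n : nat) : {T : Type & T -> C} :=
  match n with
  | 0 => existT (fun T : Type => T -> C) unit (fun=> uc_pt C)
  | S m => existT (fun T : Type => T -> C)
      {A : projT1 (obint C m) & Hom (projT2 (obint C m) A) (uc_U C)}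
      (fun B => ext (projT2 B))
  end.

Definition Obn (C : UniverseCategory) (n : nat) : Type := projT1 (obint C n).

Definition intn (C : UniverseCategory) (n : nat) (A : Obn C n) : C :=
  projT2 (obint C n) A.
Arguments intn {C} n A.

Definition cc_ob (C : UniverseCategory) : Type := {n : nat & Obn C n}.

Definition cc_int (C : UniverseCategory) (X : cc_ob C) : C :=
  intn (projT1 X) (projT2 X).

Definition cc_cons (C : UniverseCategory) (X : cc_ob C)
    (F : Hom (cc_int X) (uc_U C)) : cc_ob C :=
  existT (Obn C) (projT1 X).+1
    (existT (fun A : Obn C (projT1 X) => Hom (intn _ A) (uc_U C))
       (projT2 X) F).

Definition cc_cat (C : UniverseCategory) : Category := {|
  Ob := cc_ob C;
  Hom := fun X Y => Hom (cc_int X) (cc_int Y);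
  idm := fun X => idm (cc_int X);
  compm := fun X Y Z f g => f ;; g;
  comp1f := fun X Y f => comp1f f;
  compf1 := fun X Y f => compf1 f;
  compA := fun X Y Z W f g h => compA f g h
|}.

Definition cc_l (C : UniverseCategory) (X : cc_cat C) : nat := projT1 X.

Definition cc_pt (C : UniverseCategory) : cc_cat C := existT (Obn C) 0 tt.

Definition cc_ft (C : UniverseCategory) (X : cc_cat C) : cc_cat C :=
  match X with
  | existT 0 A => existT (Obn C) 0 A
  | existT (S n) A => existT (Obn C) n (projT1 A)
  end.

Definition cc_p (C : UniverseCategory) (X : cc_cat C) : Hom X (cc_ft X) :=
  match X return @Hom (cc_cat C) X (cc_ft X) with
  | existT 0 A => idm (intn 0 A)
  | existT (S n) A => pr (projT2 A)
  end.

(* The type [F] of the last variable of a context of positive length. *)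
Definition cc_last (C : UniverseCategory) (X : cc_cat C) :
    0 < cc_l X -> Hom (cc_int (cc_ft X)) (uc_U C) :=
  match X return 0 < cc_l X -> Hom (cc_int (cc_ft X)) (uc_U C) with
  | existT 0 A => fun h => False_rect _ (notF h)
  | existT (S n) A => fun _ => projT2 A
  end.

Definition cc_pull (C : UniverseCategory) (X : cc_cat C) (hX : 0 < cc_l X)
    (Y : cc_cat C) (f : Hom Y (cc_ft X)) : cc_cat C :=
  @cc_cons C Y (@compm C _ _ _ f (cc_last hX)).

Definition cc_q (C : UniverseCategory) (X : cc_cat C) :
    forall (hX : 0 < cc_l X) (Y : cc_cat C) (f : Hom Y (cc_ft X)),
    Hom (cc_pull hX f) X :=
  match X return forall (hX : 0 < cc_l X) (Y : cc_cat C)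
    (f : @Hom (cc_cat C) Y (cc_ft X)), @Hom (cc_cat C) (cc_pull hX f) X with
  | existT 0 A => fun h => False_rect _ (notF h)
  | existT (S n) A => fun _ Y f => Q2 (f : @Hom C (cc_int Y) _) (projT2 A)
  end.

Lemma cc_s_comm (C : UniverseCategory) (X : C) (F : Hom X (uc_U C)) (Y : C)
    (f : Hom Y (ext F)) :
  idm Y ;; (f ;; pr F ;; F) = (f ;; Qm F) ;; uc_mor C.
Proof.
by rewrite comp1f -!compA (proj1 (canonical_square F)).
Qed.

(* [s_f = Id * (int(f) ;; Q(F))]; see [cc_s_uniq] below. *)
Definition cc_s (C : UniverseCategory) (X : cc_cat C) :
    forall (hX : 0 < cc_l X) (Y : cc_cat C) (f : Hom Y X),
    Hom Y (cc_pull hX (f ;; cc_p X)) :=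
  match X return forall (hX : 0 < cc_l X) (Y : cc_cat C)
    (f : @Hom (cc_cat C) Y X),
    @Hom (cc_cat C) Y (cc_pull hX (f ;; cc_p X)) with
  | existT 0 A => fun h => False_rect _ (notF h)
  | existT (S n) A => fun _ Y f =>
      star (cc_s_comm (f : @Hom C (cc_int Y) (ext (projT2 A))))
  end.

Section CCProofs.
Context (C : UniverseCategory).
Implicit Types X Y Z W : cc_cat C.

Lemma cc_l0 X : cc_l X = 0 <-> X = cc_pt C.
Proof. by case: X => [[|n] A]; split=> //=; case: A. Qed.

Lemma cc_l_ft X : 0 < cc_l X -> cc_l (cc_ft X) = cc_l X - 1.
Proof. by case: X => [[|n] A] // _; rewrite /cc_l /= subn1. Qed.

Lemma cc_ft_pt : cc_ft (cc_pt C) = cc_pt C.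
Proof. by []. Qed.

Lemma cc_pt_final : is_final (cc_pt C).
Proof. by move=> X; exact: (@uc_final C (cc_int X)). Qed.

Lemma cc_l_pull X (hX : 0 < cc_l X) Y (f : Hom Y (cc_ft X)) :
  0 < cc_l (cc_pull hX f).
Proof. by []. Qed.

Lemma cc_ft_pull X (hX : 0 < cc_l X) Y (f : Hom Y (cc_ft X)) :
  cc_ft (cc_pull hX f) = Y.
Proof. by case: Y f. Qed.

Lemma cc_p_cons Y (F : Hom (cc_int Y) (uc_U C)) (e : cc_ft (cc_cons F) = Y) :
  cc_p (cc_cons F) ;; eqmor e = pr F :> @Hom (cc_cat C) _ _.
Proof. by case: Y F e => n A F e /=; rewrite eqmor_id; exact: compf1. Qed.

Lemma cc_p_pull X (hX : 0 < cc_l X) Y (f : Hom Y (cc_ft X)) :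
  cc_p (cc_pull hX f) ;; eqmor (cc_ft_pull hX f) ;; f = cc_q hX f ;; cc_p X.
Proof.
rewrite cc_p_cons; case: X hX f => [[|n] A] // hX f.
by rewrite /= Q2_pr.
Qed.

Lemma arr_cons_src Y (F1 F2 : Hom (cc_int Y) (uc_U C)) Z
    (a : @Hom (cc_cat C) (cc_cons F1) Z) (b : @Hom (cc_cat C) (cc_cons F2) Z) :
  F1 = F2 ->
  (forall c : @Hom C (ext F1) (ext F2),
     c ;; pr F2 = pr F1 -> c ;; Qm F2 = Qm F1 ->
     @compm C _ _ _ c b = a) -> arr a = arr b.
Proof.
move=> e; case: _ / e b => b /(_ (idm _)) h.
by rewrite -h ?comp1f.
Qed.

Lemma arr_cons_tgt Y (F1 F2 : Hom (cc_int Y) (uc_U C)) Z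
    (a : @Hom (cc_cat C) Z (cc_cons F1)) (b : @Hom (cc_cat C) Z (cc_cons F2)) :
  F1 = F2 -> @compm C _ _ _ a (pr F1) = @compm C _ _ _ b (pr F2) ->
  @compm C _ _ _ a (Qm F1) = @compm C _ _ _ b (Qm F2) -> arr a = arr b.
Proof.
move=> e; case: _ / e b => b h1 h2.
by congr arr; exact: ext_uniq.
Qed.

Lemma cc_q_id X (hX : 0 < cc_l X) :
  arr (cc_q hX (idm (cc_ft X))) = arr (idm X).
Proof.
case: X hX => [[|n] A] // hX; case: A hX => A F hX.
apply: (@arr_cons_src (existT _ n A) (idm _ ;; F) F
  (existT _ n.+1 (existT _ A F))); first exact: comp1f.
move=> c cp cQ; rewrite [LHS]compf1; apply: ext_uniq.
  by rewrite Q2_pr cp compf1.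
by rewrite Q2_Q cQ.
Qed.

Lemma cc_pull_id X (hX : 0 < cc_l X) : cc_pull hX (idm (cc_ft X)) = X.
Proof. by have /(congr1 (@projT1 _ _)) := cc_q_id hX. Qed.

Lemma cc_q_comp X (hX : 0 < cc_l X) Y (f : Hom Y (cc_ft X)) Z (g : Hom Z Y) :
  arr (cc_q hX (g ;; f)) =
  arr (cc_q (cc_l_pull hX f) (g ;; eqmor (esym (cc_ft_pull hX f)))
       ;; cc_q hX f).
Proof.
case: X hX f => [[|n] A] // hX f; case: Y f g => m B f g.
rewrite eqmor_id [g ;; idm _]compf1.
apply: (@arr_cons_src Z) => [|c cp cQ]; first by rewrite /= compA.
exact: Q2_comp cp cQ.
Qed.

Lemma cc_pull_comp X (hX : 0 < cc_l X) Y (f : Hom Y (cc_ft X))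
    Z (g : Hom Z Y) :
  cc_pull hX (g ;; f) =
  cc_pull (cc_l_pull hX f) (g ;; eqmor (esym (cc_ft_pull hX f))).
Proof. by have /(congr1 (@projT1 _ _)) := cc_q_comp hX f g. Qed.

Lemma cc_s_p X (hX : 0 < cc_l X) Y (f : Hom Y X) :
  cc_s hX f ;; cc_p (cc_pull hX (f ;; cc_p X))
    ;; eqmor (cc_ft_pull hX (f ;; cc_p X)) = idm Y.
Proof.
rewrite -[LHS]compA [X in _ ;; X]cc_p_cons.
by case: X hX f => [[|n] A] // hX f; exact: star_pr.
Qed.

Lemma cc_s_q X (hX : 0 < cc_l X) Y (f : Hom Y X) :
  f = cc_s hX f ;; cc_q hX (f ;; cc_p X).
Proof.
case: X hX f => [[|n] A] // hX f; apply: ext_uniq => /=.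
  by rewrite Q2_prA star_pr comp1f.
by rewrite Q2_QA star_Q.
Qed.

Lemma cc_s_uniq X (hX : 0 < cc_l X) Y (f : Hom Y X)
    (t : Hom Y (cc_pull hX (f ;; cc_p X))) :
  t ;; cc_p (cc_pull hX (f ;; cc_p X))
    ;; eqmor (cc_ft_pull hX (f ;; cc_p X)) = idm Y ->
  f = t ;; cc_q hX (f ;; cc_p X) -> t = cc_s hX f.
Proof.
move=> tp tq; have sp := cc_s_p hX f; have sq := cc_s_q hX f.
move: tp sp; rewrite -![t ;; _ ;; _]compA -![cc_s _ _ ;; _ ;; _]compA.
rewrite [X in _ ;; X]cc_p_cons => tp.
rewrite [X in _ ;; X]cc_p_cons => sp; apply: ext_uniq.
  exact: etrans tp (esym sp).
move: sq; rewrite {1}tq {tp sp}.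
case: X hX f t tq => [[|n] A] // hX f t _ /(congr1 (fun h => h ;; Qm _)).
by rewrite /= !Q2_QA.
Qed.

Lemma cc_s_pull X (hX : 0 < cc_l X) Z (hZ : 0 < cc_l Z)
    (g : Hom (cc_ft X) (cc_ft Z)) (e : X = cc_pull hZ g) Y (f : Hom Y X) :
  arr (cc_s hX f) = arr (cc_s hZ (f ;; eqmor e ;; cc_q hZ g)).
Proof.
suff gen W (g' : Hom W (cc_ft Z)) (e' : X = cc_pull hZ g') :
    arr (cc_s hX f) = arr (cc_s hZ (f ;; eqmor e' ;; cc_q hZ g')).
  exact: gen.
subst X; rewrite eqmor_id [f ;; idm _]compf1.
case: Z hZ g' hX f {g e} => [[|n] A] // hZ g hX f.
apply: (@arr_cons_tgt Y).
- by rewrite /= Q2_prA compA.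
- by rewrite !star_pr.
- by rewrite !star_Q Q2_QA.
Qed.

End CCProofs.

Definition cc_c0 (C : UniverseCategory) : C0System := {|
  c0_cat := cc_cat C;
  c0_l := @cc_l C;
  c0_pt := cc_pt C;
  c0_ft := @cc_ft C;
  c0_p := @cc_p C;
  c0_pull := @cc_pull C;
  c0_q := @cc_q C;
  c0_l0 := @cc_l0 C;
  c0_l_ft := @cc_l_ft C;
  c0_ft_pt := @cc_ft_pt C;
  c0_pt_final := @cc_pt_final C;
  c0_l_pull := @cc_l_pull C;
  c0_ft_pull := @cc_ft_pull C;
  c0_p_pull := @cc_p_pull C;
  c0_pull_id := @cc_pull_id C;
  c0_q_id := @cc_q_id C;
  c0_pull_comp := @cc_pull_comp C;
  c0_q_comp := @cc_q_comp C
|}.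

Definition CC (C : UniverseCategory) : CSystem := {|
  cs_c0 := cc_c0 C;
  cs_s := @cc_s C;
  cs_s_p := @cc_s_p C;
  cs_s_q := @cc_s_q C;
  cs_s_pull := @cc_s_pull C
|}.

Record UCFunctor (C D : UniverseCategory) := {
  ucf_fun :> Functor C D;
  ucf_phi : Hom (ucf_fun (uc_U C)) (uc_U D);
  ucf_phit : Hom (ucf_fun (uc_Ut C)) (uc_Ut D);
  ucf_pullback : forall (X : C) (F : Hom X (uc_U C)),
    is_pullback (fmor ucf_fun (pr F)) (fmor ucf_fun (Qm F))
                (fmor ucf_fun F) (fmor ucf_fun (uc_mor C));
  ucf_final : is_final (ucf_fun (uc_pt C));
  ucf_square : is_pullback (fmor ucf_fun (uc_mor C)) ucf_phit
                           ucf_phi (uc_mor D)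
}.

Section PsiStep.
Context {C D : UniverseCategory} (Phi : UCFunctor C D).
Context {X : C} {X' : D} (psi : Iso X' (Phi X)) (F : Hom X (uc_U C)).

Definition H_type : Hom X' (uc_U D) := psi ;; fmor Phi F ;; ucf_phi Phi.

Lemma ucf_ext_pullback :
  is_pullback (fmor Phi (pr F)) (fmor Phi (Qm F) ;; ucf_phit Phi)
              (fmor Phi F ;; ucf_phi Phi) (uc_mor D).
Proof.
have [c1 u1] := ucf_pullback Phi F; have [c2 u2] := ucf_square Phi.
split=> [|W u v e]; first by rewrite compA c1 -compA c2 compA.
have [|w1 [[e1 e2] un1]] := u2 W (u ;; fmor Phi F) v; first by rewrite -compA.
have [|w2 [[e3 e4] un2]] := u1 W u w1; first by rewrite e1.
exists w2; split=> [|w [h1 h2]]; first by rewrite compA e4.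
apply: un2; split=> //; symmetry; apply: un1; split; last by rewrite -compA.
by rewrite -compA -c1 compA h1.
Qed.

Lemma psi_step_hom_comm :
  (pr H_type ;; psi) ;; (fmor Phi F ;; ucf_phi Phi) = Qm H_type ;; uc_mor D.
Proof.
by rewrite -(proj1 (canonical_square H_type)) /H_type -!compA.
Qed.

Definition psi_step_hom : Hom (ext H_type) (Phi (ext F)) :=
  pb_lift ucf_ext_pullback psi_step_hom_comm.

Lemma psi_step_pr :
  psi_step_hom ;; fmor Phi (pr F) = pr H_type ;; psi.
Proof. exact: pb_lift_fst. Qed.

Lemma psi_step_Q :
  psi_step_hom ;; fmor Phi (Qm F) ;; ucf_phit Phi = Qm H_type.
Proof. by rewrite -compA; exact: pb_lift_snd. Qed.

Lemma psi_step_uniq (h : Hom (ext H_type) (Phi (ext F))) :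
  h ;; fmor Phi (pr F) = pr H_type ;; psi ->
  h ;; fmor Phi (Qm F) ;; ucf_phit Phi = Qm H_type -> h = psi_step_hom.
Proof.
move=> h1 h2; apply: (pullback_uniq ucf_ext_pullback).
  by rewrite psi_step_pr.
by rewrite !compA psi_step_Q.
Qed.

Lemma psi_step_inv_comm :
  (fmor Phi (pr F) ;; iso_inv psi) ;; H_type =
  (fmor Phi (Qm F) ;; ucf_phit Phi) ;; uc_mor D.
Proof.
rewrite -(proj1 ucf_ext_pullback) /H_type -!compA; congr compm.
by rewrite compA iso_invK comp1f.
Qed.

Definition psi_step_inv : Hom (Phi (ext F)) (ext H_type) :=
  star psi_step_inv_comm.

Lemma psi_step_inverses : inverses psi_step_hom psi_step_inv.
Proof.
split.
  apply: ext_uniq; rewrite comp1f -compA.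
    by rewrite star_pr compA psi_step_pr -compA iso_homK compf1.
  by rewrite star_Q compA psi_step_Q.
apply: (pullback_uniq ucf_ext_pullback); rewrite comp1f -compA.
  by rewrite psi_step_pr compA star_pr -compA iso_invK compf1.
by rewrite (compA psi_step_hom) psi_step_Q star_Q.
Qed.

Definition psi_step : Iso (ext H_type) (Phi (ext F)) :=
  {| iso_hom := psi_step_hom; iso_inv := psi_step_inv;
     iso_inverses := psi_step_inverses |}.

End PsiStep.

Section PsiZero.
Context {C D : UniverseCategory} (Phi : UCFunctor C D).

Definition psi_zero : Iso (uc_pt D) (Phi (uc_pt C)) :=
  {| iso_hom := final_map (ucf_final Phi) (uc_pt D);
     iso_inv := final_map (@uc_final D) (Phi (uc_pt C));
     iso_inverses := conj (final_uniq (@uc_final D) _ _)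
                          (final_uniq (ucf_final Phi) _ _) |}.

End PsiZero.

(* [H_n] and [psi_n] by simultaneous recursion on [n]. *)
Fixpoint H_psi (C D : UniverseCategory) (Phi : UCFunctor C D) (n : nat) :
    forall A : Obn C n, {B : Obn D n & Iso (intn n B) (Phi (intn n A))} :=
  match n return forall A : Obn C n,
      {B : Obn D n & Iso (intn n B) (Phi (intn n A))} with
  | 0 => fun=> existT
      (fun B : Obn D 0 => Iso (intn 0 B) (Phi (uc_pt C))) tt (psi_zero Phi)
  | S m => fun AF =>
      let A : Obn C m := projT1 AF in
      let F : Hom (intn m A) (uc_U C) := projT2 AF in
      let psi := projT2 (H_psi Phi A) in
      existT (fun B : Obn D m.+1 => Iso (intn m.+1 B) (Phi (ext F)))
        (existT (fun B : Obn D m => Hom (intn m B) (uc_U D))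
           (projT1 (H_psi Phi A)) (H_type psi F))
        (psi_step psi F)
  end.

Section HomH.
Context {C D : UniverseCategory} (Phi : UCFunctor C D).

Definition H_ob (X : cc_ob C) : cc_ob D :=
  existT (Obn D) (projT1 X) (projT1 (H_psi Phi (projT2 X))).

Definition psi (X : cc_ob C) : Iso (cc_int (H_ob X)) (Phi (cc_int X)) :=
  projT2 (H_psi Phi (projT2 X)).

Definition H_mor (X Y : cc_ob C) (a : Hom (cc_int X) (cc_int Y)) :
  Hom (cc_int (H_ob X)) (cc_int (H_ob Y)) :=
  psi X ;; fmor Phi a ;; iso_inv (psi Y).

Lemma H_mor_id (X : cc_ob C) : H_mor (idm (cc_int X)) = idm _.
Proof. by rewrite /H_mor fmor_id compf1 iso_homK. Qed.

Lemma H_mor_comp (X Y Z : cc_ob C) (a : Hom (cc_int X) (cc_int Y))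
    (b : Hom (cc_int Y) (cc_int Z)) :
  H_mor (a ;; b) = H_mor a ;; H_mor b.
Proof.
rewrite /H_mor fmor_comp -!compA; do 2!congr compm.
by rewrite !compA iso_invK comp1f.
Qed.

Definition H_fun : Functor (cc_cat C) (cc_cat D) :=
  @Build_Functor (cc_cat C) (cc_cat D) H_ob H_mor H_mor_id H_mor_comp.

Lemma H_l (X : cc_cat C) : cc_l (H_fun X) = cc_l X.
Proof. by []. Qed.

Lemma H_ft (X : cc_cat C) : cc_ft (H_fun X) = H_fun (cc_ft X).
Proof. by case: X => [[|n] A]. Qed.

Lemma H_p (X : cc_cat C) : arr (fmor H_fun (cc_p X)) = arr (cc_p (H_fun X)).
Proof.
case: X => [[|n] A]; first by congr arr; exact: H_mor_id.
congr arr; rewrite /= /H_mor /= psi_step_pr -compA.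
by rewrite -[RHS]compf1; congr compm; exact: iso_homK.
Qed.

Lemma H_type_comp (X' X : C) (Y' Y : D) (i : Iso Y' (Phi X'))
    (j : Iso Y (Phi X)) (f : Hom X' X) (F : Hom X (uc_U C)) :
  H_type i (f ;; F) = (i ;; fmor Phi f ;; iso_inv j) ;; H_type j F.
Proof.
rewrite /H_type fmor_comp !compA; do 2!congr compm.
by rewrite -[X in X = _]compf1 -(iso_invK j) compA.
Qed.

Lemma psi_step_inv_pr (X : C) (X' : D) (i : Iso X' (Phi X))
    (F : Hom X (uc_U C)) :
  psi_step_inv i F ;; pr (H_type i F) = fmor Phi (pr F) ;; iso_inv i.
Proof. exact: star_pr. Qed.

Lemma psi_step_inv_Q (X : C) (X' : D) (i : Iso X' (Phi X))
    (F : Hom X (uc_U C)) :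
  psi_step_inv i F ;; Qm (H_type i F) = fmor Phi (Qm F) ;; ucf_phit Phi.
Proof. exact: star_Q. Qed.

Section HTransport.
Context {X' X : C} {Y' Y : D} (i : Iso Y' (Phi X')) (j : Iso Y (Phi X))
  (F : Hom X (uc_U C)).

Lemma H_Q2_pr (f : Hom X' X) :
  psi_step_hom i (f ;; F) ;; fmor Phi (Q2 f F) ;; psi_step_inv j F
    ;; pr (H_type j F) =
  pr (H_type i (f ;; F)) ;; (i ;; fmor Phi f ;; iso_inv j).
Proof.
rewrite -compA psi_step_inv_pr compA.
rewrite -(compA (psi_step_hom _ _)) -fmor_comp Q2_pr fmor_comp compA psi_step_pr.
by rewrite -!compA.
Qed.

Lemma H_Q2_Q (f : Hom X' X) :
  psi_step_hom i (f ;; F) ;; fmor Phi (Q2 f F) ;; psi_step_inv j F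
    ;; Qm (H_type j F) = Qm (H_type i (f ;; F)).
Proof.
rewrite -compA psi_step_inv_Q compA.
by rewrite -(compA (psi_step_hom _ _)) -fmor_comp Q2_Q psi_step_Q.
Qed.

Lemma H_type_pr (f : Hom X' (ext F)) :
  H_type i (f ;; pr F ;; F) =
  (i ;; fmor Phi f ;; psi_step_inv j F) ;; pr (H_type j F) ;; H_type j F.
Proof.
rewrite (H_type_comp i j) -(compA _ (psi_step_inv j F)).
by rewrite psi_step_inv_pr fmor_comp !compA.
Qed.

Lemma H_star_pr (f : Hom X' (ext F)) :
  i ;; fmor Phi (star (cc_s_comm f)) ;; psi_step_inv i (f ;; pr F ;; F)
    ;; pr (H_type i (f ;; pr F ;; F)) = idm Y'.
Proof.
rewrite -compA psi_step_inv_pr compA.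
by rewrite -(compA i) -fmor_comp star_pr fmor_id compf1 iso_homK.
Qed.

Lemma H_star_Q (f : Hom X' (ext F)) :
  i ;; fmor Phi (star (cc_s_comm f)) ;; psi_step_inv i (f ;; pr F ;; F)
    ;; Qm (H_type i (f ;; pr F ;; F)) =
  i ;; fmor Phi f ;; psi_step_inv j F ;; Qm (H_type j F).
Proof.
rewrite -compA psi_step_inv_Q compA.
rewrite -(compA i) -fmor_comp star_Q fmor_comp.
by rewrite -[RHS]compA psi_step_inv_Q !compA.
Qed.

End HTransport.

Lemma H_q (Y : cc_cat C) (hY : 0 < cc_l Y) (hY' : 0 < cc_l (H_fun Y))
    (X : cc_cat C) (f : Hom X (cc_ft Y)) :
  arr (fmor H_fun (cc_q hY f)) =
  arr (cc_q hY' (fmor H_fun f ;; eqmor (esym (H_ft Y)))).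
Proof.
case: Y hY hY' f => [[|n] A] // hY hY' f.
rewrite eqmor_id [_ ;; idm _]compf1.
apply: (@arr_cons_src D (H_ob X)) => [|c cp cQ]; first exact: H_type_comp.
apply: ext_uniq.
  by rewrite Q2_prA cp; symmetry; exact: H_Q2_pr.
by rewrite Q2_QA cQ; symmetry; exact: H_Q2_Q.
Qed.

Lemma H_s (Y : cc_cat C) (hY : 0 < cc_l Y) (hY' : 0 < cc_l (H_fun Y))
    (X : cc_cat C) (f : Hom X Y) :
  arr (fmor H_fun (cc_s hY f)) = arr (cc_s hY' (fmor H_fun f)).
Proof.
case: Y hY hY' f => [[|n] A] // hY hY' f.
apply: (@arr_cons_tgt D (H_ob X)).
- exact: H_type_pr.
- by rewrite star_pr; exact: H_star_pr.
- by rewrite star_Q; exact: H_star_Q.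
Qed.

End HomH.

Definition H (C D : UniverseCategory) (Phi : UCFunctor C D) :
  CSystemHom (CC C) (CC D) :=
  @Build_CSystemHom (CC C) (CC D) (H_fun Phi) (@H_l C D Phi) (@H_ft C D Phi)
    (@H_p C D Phi) (@H_q C D Phi) (@H_s C D Phi).

(* Main.v *)
From mathcomp Require Import ssreflect ssrfun ssrbool eqtype ssrnat.
From Stdlib Require Import Description ProofIrrelevance.
Require Import Defs.

Set Implicit Arguments.
Unset Strict Implicit.
Unset Printing Implicit Defensive.

Local Open Scope cat_scope.

(** The map on objects sends a context [(A, F)] to
    [(H_n A, psi A ;; Phi F ;; phi)].  Since [psi A] is invertible, the second
    component depends injectively on [F] as soon as [Phi] is faithful and [phi]
    is a monomorphism, and every morphism [int (H_n A) -> U'] has this form as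
    soon as [Phi] is full and [phi] is invertible; induction on the length
    turns this into injectivity ([H_ob_inj]) and surjectivity ([H_ob_surj]) on
    objects.  On each set of morphisms [H] is [Phi] conjugated by the
    isomorphisms [psi], so it inherits faithfulness ([H_faithful]) and full
    faithfulness ([H_fully_faithful]) from [Phi].

    This gives the first claim, because a faithful functor that is injective on
    objects is injective on the set of all morphisms ([fMor_inj]).  The second
    claim is then purely algebraic: a homomorphism of C-systems that is
    bijective on objects and fully faithful has an inverse functor, and this
    inverse automatically preserves [p], [q] and [s], because the required
    equations may be checked after applying the homomorphism, which is
    injective on morphisms ([cs_isomorphism_of_bijective]). *)

Lemma existT_inj (T : Type) (P : T -> Type) (t : T) (x y : P t) :
  existT P t x = existT P t y -> x = y.
Proof. exact: ProofIrrelevanceTheory.EqdepTheory.inj_pair2. Qed.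

Lemma inj_surj_bijective (S T : Type) (f : S -> T) :
  injective f -> (forall y, exists x, f x = y) -> bijective f.
Proof.
move=> fI fS.
have fU y : exists! x, f x = y.
  by have [x <-] := fS y; exists x; split=> // x' /fI.
pose g y := proj1_sig (constructive_definite_description _ (fU y)).
have gK : cancel g f.
  by move=> y; rewrite /g; case: constructive_definite_description.
by exists g => // x; apply: fI; rewrite gK.
Qed.

(** * Categories and functors *)

Lemma is_iso_mono (C : Category) (X Y : C) (f : Hom X Y) : is_iso f -> mono f.
Proof.
case=> f' [ff' _] W g h /(congr1 (fun k => k ;; f')).
by rewrite -!compA ff' !compf1.
Qed.

Section Arrows.
Context {C : Category}.
Implicit Types X Y Z : C.

(** Both components of [arr f] are dependent pairs over objects, so this rests on
    the uniqueness of proofs of equality between objects. *)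
Lemma arr_inj X Y (f g : Hom X Y) : arr f = arr g -> f = g.
Proof. by move=> e; exact: existT_inj (existT_inj e). Qed.

Lemma arr_dom X Y X' Y' (f : Hom X Y) (g : Hom X' Y') :
  arr f = arr g -> X = X'.
Proof. exact: (congr1 (@projT1 _ _)). Qed.

Lemma arr_cod X Y X' Y' (f : Hom X Y) (g : Hom X' Y') :
  arr f = arr g -> Y = Y'.
Proof. exact: (congr1 (fun m : Mor C => projT1 (projT2 m))). Qed.

Lemma arr_eqmorr X Y Z (f : Hom X Y) (e : Y = Z) : arr (f ;; eqmor e) = arr f.
Proof. by case: Z / e; rewrite /= compf1. Qed.

Lemma arr_eqmorl X Y Z (e : X = Y) (f : Hom Y Z) : arr (eqmor e ;; f) = arr f.
Proof. by case: Y / e f => f; rewrite /= comp1f. Qed.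

Lemma arr_comp X Y Z X' Y' Z' (f : Hom X Y) (g : Hom Y Z)
    (f' : Hom X' Y') (g' : Hom Y' Z') :
  arr f = arr f' -> arr g = arr g' -> arr (f ;; g) = arr (f' ;; g').
Proof.
move=> ef eg; move: (arr_dom ef) (arr_cod ef) (arr_cod eg) => eX eY eZ.
by subst X' Y' Z'; rewrite (arr_inj ef) (arr_inj eg).
Qed.

End Arrows.

Lemma fMor_inj (C D : Category) (F : Functor C D) :
  injective (fob F) -> faithful F -> injective (fMor F).
Proof.
move=> FI FF [X [Y f]] [X' [Y' f']] e.
have eX : X = X' := FI _ _ (arr_dom e).
have eY : Y = Y' := FI _ _ (arr_cod e).
by subst X' Y'; congr arr; apply: FF; exact: arr_inj e.
Qed.

Lemma fully_faithful_faithful (C D : Category) (F : Functor C D) :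
  fully_faithful F -> faithful F.
Proof. by move=> FF X Y; apply: bij_inj. Qed.

Section Preimage.
Context {C D : Category} (F : Functor C D) (FF : fully_faithful F).

Lemma fmor_exists_unique (X Y : C) (g : Hom (F X) (F Y)) :
  exists! f : Hom X Y, fmor F f = g.
Proof.
have [h hK Kh] := FF X Y.
by exists (h g); split=> [|f <-]; [exact: Kh | exact: hK].
Qed.

Definition fmor_preim (X Y : C) (g : Hom (F X) (F Y)) : Hom X Y :=
  proj1_sig (constructive_definite_description _ (fmor_exists_unique g)).

Lemma fmor_preimK (X Y : C) (g : Hom (F X) (F Y)) :
  fmor F (fmor_preim g) = g.
Proof. by rewrite /fmor_preim; case: constructive_definite_description. Qed.

Lemma fmor_bij_inj (X Y : C) (f f' : Hom X Y) :
  fmor F f = fmor F f' -> f = f'.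
Proof. exact: fully_faithful_faithful. Qed.

End Preimage.

(** * Inverting a bijective homomorphism of C-systems *)

Section InverseFunctor.
Context {C D : Category} (F : Functor C D) (FF : fully_faithful F).
Context (g : D -> C) (Fg : cancel g (fob F)).

(** The object equations [F (g Y) = Y] are only provable, so a morphism is
    carried along them to the domain of [fmor_preim]. *)
Definition inv_mor (Y Z : D) (f : Hom Y Z) : Hom (g Y) (g Z) :=
  fmor_preim FF (eqmor (Fg Y) ;; f ;; eqmor (esym (Fg Z))).

Lemma arr_inv_mor (Y Z : D) (f : Hom Y Z) : arr (fmor F (inv_mor f)) = arr f.
Proof. by rewrite fmor_preimK arr_eqmorr arr_eqmorl. Qed.

Lemma inv_mor_id (Y : D) : inv_mor (idm Y) = idm (g Y).
Proof.
apply: (fmor_bij_inj FF); apply: arr_inj.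
by rewrite arr_inv_mor fmor_id Fg.
Qed.

Lemma inv_mor_comp (X Y Z : D) (f : Hom X Y) (h : Hom Y Z) :
  inv_mor (f ;; h) = inv_mor f ;; inv_mor h.
Proof.
apply: (fmor_bij_inj FF); apply: arr_inj; rewrite arr_inv_mor fmor_comp.
by apply: arr_comp; rewrite arr_inv_mor.
Qed.

Definition inv_functor : Functor D C :=
  {| fob := g; fmor := inv_mor;
     fmor_id := inv_mor_id; fmor_comp := inv_mor_comp |}.

Lemma fMor_inv_functor : cancel (fMor inv_functor) (fMor F).
Proof. by case=> [X [Y f]]; exact: arr_inv_mor. Qed.

End InverseFunctor.

Lemma c0_q_congr (A : C0System) (Y Y' : A) (hY : 0 < c0_l Y)
    (hY' : 0 < c0_l Y') (X X' : A) (f : Hom X (c0_ft Y))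
    (f' : Hom X' (c0_ft Y')) :
  Y = Y' -> arr f = arr f' -> arr (c0_q hY f) = arr (c0_q hY' f').
Proof.
move=> eY; subst Y' => ef; move: (arr_dom ef) => eX; subst X'.
by rewrite (arr_inj ef) (eq_irrelevance hY hY').
Qed.

Lemma cs_s_congr (A : CSystem) (Y Y' : A) (hY : 0 < c0_l Y)
    (hY' : 0 < c0_l Y') (X X' : A) (f : Hom X Y) (f' : Hom X' Y') :
  arr f = arr f' -> arr (cs_s hY f) = arr (cs_s hY' f').
Proof.
move=> ef; move: (arr_dom ef) (arr_cod ef) => eX eY; subst X' Y'.
by rewrite (arr_inj ef) (eq_irrelevance hY hY').
Qed.

Section InverseHom.
Context {A B : CSystem} (F : CSystemHom A B) (FF : fully_faithful F).
Context (g : B -> A) (gF : cancel (fob F) g) (Fg : cancel g (fob F)).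

Let G : Functor B A := inv_functor FF Fg.

(** The equations that make [G] a homomorphism are cancelled down from their
    images under [F]: there [F] commutes with the operations of [A] and
    [F (G f)] is [f] up to the object equations, so both sides agree. *)
Lemma inv_hom_MorI : injective (fMor F).
Proof. exact: fMor_inj (can_inj gF) (fully_faithful_faithful FF). Qed.

Lemma inv_hom_l (Y : B) : c0_l (G Y) = c0_l Y.
Proof. by rewrite -(csh_l F) Fg. Qed.

Lemma inv_hom_ft (Y : B) : c0_ft (G Y) = G (c0_ft Y).
Proof. by apply: (can_inj gF); rewrite -csh_ft !Fg. Qed.

Lemma inv_hom_p (Y : B) : arr (fmor G (c0_p Y)) = arr (c0_p (G Y)).
Proof.
apply: inv_hom_MorI; rewrite [LHS]arr_inv_mor.
by rewrite [RHS](csh_p F) Fg.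
Qed.

Lemma inv_hom_q (Y : B) (hY : 0 < c0_l Y) (hY' : 0 < c0_l (G Y))
    (X : B) (f : Hom X (c0_ft Y)) :
  arr (fmor G (c0_q hY f)) =
  arr (c0_q hY' (fmor G f ;; eqmor (esym (inv_hom_ft Y)))).
Proof.
apply: inv_hom_MorI; rewrite [LHS]arr_inv_mor.
have hFY : 0 < c0_l (F (G Y)) by rewrite csh_l.
rewrite [RHS](csh_q _ hFY); apply: c0_q_congr; first by rewrite Fg.
rewrite arr_eqmorr -[LHS](arr_inv_mor FF Fg).
exact: esym (congr1 (fMor F) (arr_eqmorr _ _)).
Qed.

Lemma inv_hom_s (Y : B) (hY : 0 < c0_l Y) (hY' : 0 < c0_l (G Y))
    (X : B) (f : Hom X Y) :
  arr (fmor G (cs_s hY f)) = arr (cs_s hY' (fmor G f)).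
Proof.
apply: inv_hom_MorI; rewrite [LHS]arr_inv_mor.
have hFY : 0 < c0_l (F (G Y)) by rewrite csh_l.
rewrite [RHS](csh_s _ hFY); apply: cs_s_congr.
by rewrite arr_inv_mor.
Qed.

Definition inv_hom : CSystemHom B A :=
  {| csh_fun := G; csh_l := inv_hom_l; csh_ft := inv_hom_ft;
     csh_p := inv_hom_p; csh_q := inv_hom_q; csh_s := inv_hom_s |}.

End InverseHom.

Theorem cs_isomorphism_of_bijective (A B : CSystem) (F : CSystemHom A B) :
  bijective (fob F) -> fully_faithful F -> cs_isomorphism F.
Proof.
case=> g gF Fg FF; exists (inv_hom FF gF Fg).
have FG : cancel (fMor (inv_hom FF gF Fg)) (fMor F).
  exact: fMor_inv_functor.
by split=> //; exact: inj_can_sym FG (inv_hom_MorI FF gF).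
Qed.

(** * The homomorphism of a functor of universe categories *)

Section HomHBijective.
Context {C D : UniverseCategory} (Phi : UCFunctor C D).

(** A context of positive length is a shorter context [A] followed by a morphism
    [F] to the universe, and [H_type i F] is what [F] becomes under [H].  This
    lemma and the next are therefore the induction steps for injectivity and
    surjectivity of [H] on objects. *)
Lemma H_type_inj (X : C) (X' : D) (i : Iso X' (Phi X)) :
  faithful Phi -> mono (ucf_phi Phi) -> injective (H_type i).
Proof.
move=> PhiF phiM F F' /phiM/(congr1 (fun k => iso_inv i ;; k)).
by rewrite !compA !iso_invK !comp1f => /PhiF.
Qed.

Lemma H_type_surj (X : C) (X' : D) (i : Iso X' (Phi X)) (F' : Hom X' (uc_U D)) :
  fully_faithful Phi -> is_iso (ucf_phi Phi) -> exists F, H_type i F = F'.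
Proof.
move=> PhiFF [phi' [_ phiK]].
exists (fmor_preim PhiFF (iso_inv i ;; F' ;; phi')).
by rewrite /H_type fmor_preimK -!compA phiK compf1 compA iso_homK comp1f.
Qed.

Lemma H_ob_inj :
  faithful Phi -> mono (ucf_phi Phi) -> injective (H_ob Phi).
Proof.
move=> PhiF phiM [n A] [n' A'] e.
have en : n = n' := congr1 (@projT1 _ _) e; subst n'; congr existT.
have {e} : projT1 (H_psi Phi A) = projT1 (H_psi Phi A') := existT_inj e.
elim: n A A' => [|n IHn]; first by do 2!case.
case=> [A F] [A' F'] e.
have eA : A = A' := IHn _ _ (congr1 (@projT1 _ _) e); subst A'.
congr existT.
exact: H_type_inj (existT_inj e).
Qed.

Lemma H_ob_surj : fully_faithful Phi -> is_iso (ucf_phi Phi) ->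
  forall Y, exists X, H_ob Phi X = Y.
Proof.
move=> PhiFF phi_iso [n B].
suff [A <-] : exists A, projT1 (H_psi Phi A) = B by exists (existT _ n A).
elim: n B => [|n IHn]; first by case; exists tt.
case=> [B F']; have [A eB] := IHn B; subst B.
have [F eF] := H_type_surj (projT2 (H_psi Phi A)) F' PhiFF phi_iso.
by exists (existT _ A F); rewrite /= eF.
Qed.

Lemma H_faithful : faithful Phi -> faithful (H Phi).
Proof.
move=> PhiF X Y a b.
move=> /(congr1 (fun k => iso_inv (psi Phi X) ;; (k : @Hom D _ _) ;; psi Phi Y)).
by rewrite /= /H_mor -!compA !iso_invK !compf1 !compA !iso_invK !comp1f => /PhiF.
Qed.

Lemma H_fully_faithful : fully_faithful Phi -> fully_faithful (H Phi).
Proof.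
move=> PhiFF X Y; apply: inj_surj_bijective.
  exact: H_faithful (fully_faithful_faithful PhiFF) X Y.
move=> b; exists (fmor_preim PhiFF (iso_inv (psi Phi X) ;; b ;; psi Phi Y)).
by rewrite /= /H_mor fmor_preimK -!compA iso_homK compf1 compA iso_homK comp1f.
Qed.

End HomHBijective.

Theorem lemma0p4p8 (C C' : UniverseCategory) (Phi : UCFunctor C C') :
  (faithful Phi -> mono (ucf_phi Phi) -> cs_injection (H Phi)) /\
  (fully_faithful Phi -> is_iso (ucf_phi Phi) -> cs_isomorphism (H Phi)).
Proof.
split=> [PhiF phiM | PhiFF phi_iso].
  have HI := H_ob_inj PhiF phiM.
  split; first exact: HI.
  by apply: (@fMor_inj _ _ (H Phi)); [exact: HI | exact: H_faithful].
apply: cs_isomorphism_of_bijective; last exact: H_fully_faithful.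
apply: inj_surj_bijective; last exact: H_ob_surj.
exact: H_ob_inj (fully_faithful_faithful PhiFF) (is_iso_mono phi_iso).
Qed.
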